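(* Suppose that $f: X\times\Theta\to\mathbb{R}$ is continuous on $X\times\Theta$, and that $C:\Theta\rightrightarrows X$ is a continuous, compact-valued correspondence with $C(\theta)\neq\emptyset$ for all $\theta\in\Theta$. Let $\gamma\ge0$. Let $T=\{(\theta_i,x^\gamma(\theta_i)) : \theta_i\in\Theta,\ i=1,\dots,m\}$ be a training data set, where $x^\gamma(\theta_i)$ is an arbitrarily chosen point of $C^\gamma(\theta_i)$, and let $\mathcal{S}=\{S_1,\dots,S_d\}$ be a triangulation of $\{\theta_1,\dots,\theta_m\}$. For $\theta\in\mathrm{Conv}(\{\theta_1,\dots,\theta_m\})$, let $j_\theta$ be an index with $\theta\in\mathrm{Conv}(S_{j_\theta})$ and define $d(S_{j_\theta})=\max\{\|p-q\| : p,q\in\mathrm{Conv}(S_{j_\theta})\}$. Then the function $\hat{x}(\theta)=\lambda^{j_\theta}_1x^\gamma(\theta^{j_\theta}_1)+\dots+\lambda^{j_\theta}_{k+1}x^\gamma(\theta^{j_\theta}_{k+1})$ satisfies the following. (a) If $\mathrm{Conv}(C^\gamma(\theta))\subseteq C(\theta)$, then for given $\varepsilon>0$ there exists $\delta>0$ such that if $d(S_{j_\theta})<\delta$, then $\hat{x}(\theta)$ is an $\varepsilon$-infeasible solution. (b) If $|f(x,\theta)-f^\ast(\theta)|\le\gamma$ for all $x\in\mathrm{Conv}(C^\gamma(\theta))$, then for given $\varepsilon>0$ there exists $\delta>0$ such that if $d(S_{j_\theta})<\delta$, then $\hat{x}(\theta)$ is an $(\varepsilon+\gamma)$-suboptimal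 solution.
   Context: Parametric optimization problem: $\min_x f(x,\theta)$ subject to $x\in C(\theta)$, where $x\in X\subset\mathbb{R}^n$ is the decision variable, $\theta\in\Theta\subset\mathbb{R}^k$ is the parameter, $f:\mathbb{R}^n\times\mathbb{R}^k\to\mathbb{R}$ is the objective function, and $C$ is a correspondence (set-valued map) from $\mathbb{R}^k$ to subsets of $\mathbb{R}^n$. Define $f^\ast(\theta)=\min_{x\in C(\theta)}f(x,\theta)$, $C^\ast(\theta)=\{x\in C(\theta): f(x,\theta)=f^\ast(\theta)\}$, with $x^\ast(\theta)$ denoting an element of $C^\ast(\theta)$, and $C^\gamma(\theta)=\{x\in C(\theta): |f(x,\theta)-f^\ast(\theta)|\le\gamma\}$. $\|\cdot\|$ is the Euclidean norm and $\mathrm{Conv}$ the convex hull. For a non-empty set $A$ of vectors and $\varepsilon>0$, $\mathcal{B}_\varepsilon(A)=\{y:\exists x\in A,\ \|x-y\|<\varepsilon\}$, and $\mathcal{B}_\delta(\theta_0)=\mathcal{B}_\delta(\{\theta_0\})$. A correspondence $C$ from the parameter space $\Theta$ is upper hemicontinuous at $\theta_0$ if for all $\varepsilon>0$ there is $\delta>0$ with $C(\theta)\subset\mathcal{B}_\varepsilon(C(\theta_0))$ for all $\theta\in\mathcal{B}_\delta(\theta_0)$; lower hemicontinuous at $\theta_0$ if for all $\varepsilon>0$ there is $\delta>0$ with $C(\theta_0)\subset\mathcal{B}_\varepsilon(C(\theta))$ for all $\theta\in\mathcal{B}_\delta(\theta_0)$; continuous at $\theta_0$ if it is both; continuous if continuous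 at every point of $\Theta$. A triangulation of $\{\theta_1,\dots,\theta_m\}\subset\mathbb{R}^k$ is a finite collection $\mathcal{S}=\{S_1,\dots,S_d\}$ of subsets of $\{\theta_1,\dots,\theta_m\}$ such that: (i) for each $j$, $|S_j|=k+1$ and $\mathrm{Conv}(S_j)$ is a $k$-dimensional simplex; (ii) $\mathrm{Conv}(\{\theta_1,\dots,\theta_m\})=\bigcup_{j=1}^d\mathrm{Conv}(S_j)$; (iii) for every non-empty $J\subseteq\{1,\dots,d\}$, $\bigcap_{j\in J}\mathrm{Conv}(S_j)=\mathrm{Conv}(\bigcap_{j\in J}S_j)$. Write $S_j=\{\theta^j_1,\dots,\theta^j_{k+1}\}$. The weights $\lambda^{j_\theta}_l$ are those of the convex combination $\theta=\sum_{l=1}^{k+1}\lambda^{j_\theta}_l\theta^{j_\theta}_l$, $\lambda^{j_\theta}_l\ge0$, $\sum_l\lambda^{j_\theta}_l=1$. For $\eta>0$, $\hat{x}(\theta)$ is an $\eta$-infeasible solution if $\hat{x}(\theta)\in\mathcal{B}_\eta(C(\theta))$, and an $\eta$-suboptimal solution if $|f(\hat{x}(\theta),\theta)-f(x^\ast(\theta),\theta)|<\eta$.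
   Formalization: In (b), it is additionally assumed that Conv(C^γ(θ)) lies in X and that x̂(θ) lies in X, since f is defined and continuous only on X×Θ; both are automatic for convex X, and without them the claim can fail or be undefined. *)

(* Defs.v *)
From HB Require Import structures.
From mathcomp Require Import all_boot all_order all_algebra.
From mathcomp Require Import all_classical all_reals all_analysis.

Set Implicit Arguments.
Unset Strict Implicit.
Unset Printing Implicit Defensive.

Import Order.TTheory GRing.Theory Num.Theory.
Import numFieldNormedType.Exports.

Local Open Scope classical_set_scope.
Local Open Scope ring_scope.

(* The norm [`|v|] of the library on row vectors is the sup norm; its topology
   is the Euclidean one, but the metric notions below need the actual
   Euclidean norm. *)
Definition enorm (R : realType) (n : nat) (v : 'rV[R]_n) : R :=
  Num.sqrt (\sum_i v ord0 i ^+ 2).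

Definition thickening (R : realType) (n : nat) (A : set 'rV[R]_n) (e : R) :
    set 'rV[R]_n :=
  [set y | exists2 x, A x & enorm (x - y) < e].

Definition convex_hull (R : realType) (n : nat) (A : set 'rV[R]_n) :
    set 'rV[R]_n :=
  [set x | exists (p : nat) (v : 'I_p -> 'rV[R]_n) (c : 'I_p -> R),
    [/\ forall i, A (v i), forall i, 0 <= c i, \sum_i c i = 1
      & x = \sum_i c i *: v i]].

(* The least and greatest elements of a set of reals; 0 if there is none. *)
Definition min_of (R : realType) (A : set R) : R := xget 0 (A `&` lbound A).
Definition max_of (R : realType) (A : set R) : R := xget 0 (A `&` ubound A).

Section Correspondences.
Context (R : realType) (k n : nat).
(* A correspondence on [Theta] is represented by a total map of which only the
   values at points of [Theta] matter; hence neighbourhoods of a parameter are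
   taken relative to [Theta]. *)
Implicit Types (Theta : set 'rV[R]_k) (C : 'rV[R]_k -> set 'rV[R]_n).

Definition upper_hemicontinuous_at Theta C (theta0 : 'rV[R]_k) : Prop :=
  forall e : R, 0 < e -> exists2 delta : R, 0 < delta &
    forall theta, Theta theta -> thickening [set theta0] delta theta ->
      C theta `<=` thickening (C theta0) e.

Definition lower_hemicontinuous_at Theta C (theta0 : 'rV[R]_k) : Prop :=
  forall e : R, 0 < e -> exists2 delta : R, 0 < delta &
    forall theta, Theta theta -> thickening [set theta0] delta theta ->
      C theta0 `<=` thickening (C theta) e.

Definition continuous_correspondence Theta C : Prop :=
  forall theta0, Theta theta0 ->
    upper_hemicontinuous_at Theta C theta0 /\
    lower_hemicontinuous_at Theta C theta0.

End Correspondences.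

Section ParametricProblem.
Context (R : realType) (k n : nat).
Implicit Types (f : 'rV[R]_n -> 'rV[R]_k -> R) (C : 'rV[R]_k -> set 'rV[R]_n).
Implicit Types (theta : 'rV[R]_k) (x : 'rV[R]_n).

Definition optimal_value f C theta : R :=
  min_of [set f x theta | x in C theta].

Definition optimal_set f C theta : set 'rV[R]_n :=
  [set x | C theta x /\ f x theta = optimal_value f C theta].

Definition suboptimal_set f C (gamma : R) theta : set 'rV[R]_n :=
  [set x | C theta x /\ `|f x theta - optimal_value f C theta| <= gamma].

Definition infeasible_solution C (eta : R) theta x : Prop :=
  thickening (C theta) eta x.

(* [f] is constant on the optimal set: the choice of [xstar] is immaterial. *)
Definition suboptimal_solution f C (eta : R) theta x : Prop :=
  exists2 xstar, optimal_set f C theta xstar &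
    `|f x theta - f xstar theta| < eta.

End ParametricProblem.

Section Triangulations.
Context (R : realType) (k : nat).

Definition affinely_independent (p : nat) (v : 'I_p -> 'rV[R]_k) : Prop :=
  forall c : 'I_p -> R,
    \sum_i c i = 0 -> \sum_i c i *: v i = 0 -> forall i, c i = 0.

Definition is_simplex (p : nat) (A : set 'rV[R]_k) : Prop :=
  exists2 v : 'I_p.+1 -> 'rV[R]_k,
    affinely_independent v & A = convex_hull (range v).

Definition triangulation (P : set 'rV[R]_k) (d : nat)
    (S : 'I_d -> set 'rV[R]_k) : Prop :=
  [/\ forall j, S j `<=` P,
      forall j, (S j #= `I_k.+1)%card /\ is_simplex k (convex_hull (S j)),
      convex_hull P = \bigcup_j convex_hull (S j)
    & forall J : set 'I_d, J !=set0 ->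
        \bigcap_(j in J) convex_hull (S j) =
        convex_hull (\bigcap_(j in J) S j)].

Definition simplex_diameter (A : set 'rV[R]_k) : R :=
  max_of [set enorm (pq.1 - pq.2) | pq in convex_hull A `*` convex_hull A].

(* [lambda] are the weights of [theta] as a convex combination of the [v i]. *)
Definition convex_weights (p : nat) (v : 'I_p -> 'rV[R]_k)
    (lambda : 'I_p -> R) (theta : 'rV[R]_k) : Prop :=
  [/\ forall l, 0 <= lambda l, \sum_l lambda l = 1
    & theta = \sum_l lambda l *: v l].

(* [v] lists the vertices of a simplex of [S] containing [theta], and [lambda]
   the corresponding weights of [theta]; since [S j] has [k.+1] points, [v] is
   automatically injective. *)
Definition located (d : nat) (S : 'I_d -> set 'rV[R]_k) (theta : 'rV[R]_k)
    (j : 'I_d) (v : 'I_k.+1 -> 'rV[R]_k) (lambda : 'I_k.+1 -> R) : Prop :=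
  [/\ convex_hull (S j) theta, S j = range v & convex_weights v lambda theta].

Definition interpolant (n : nat) (v : 'I_k.+1 -> 'rV[R]_k)
    (lambda : 'I_k.+1 -> R) (xg : 'rV[R]_k -> 'rV[R]_n) : 'rV[R]_n :=
  \sum_l lambda l *: xg (v l).

End Triangulations.

(* The data set [{(t i, xg (t i))}]. *)
Definition training_data (R : realType) (k n : nat) (Theta : set 'rV[R]_k)
    (f : 'rV[R]_n -> 'rV[R]_k -> R) (C : 'rV[R]_k -> set 'rV[R]_n) (gamma : R)
    (m : nat) (t : 'I_m -> 'rV[R]_k) (xg : 'rV[R]_k -> 'rV[R]_n) : Prop :=
  forall i, Theta (t i) /\ suboptimal_set f C gamma (t i) (xg (t i)).

(* Main.v *)
(* As theta' tends to theta, the near-optimal sets C^gamma(theta') end up in any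
   neighbourhood of C^gamma(theta): a compactness argument on C(theta) that
   needs only the joint continuity of f and the upper semicontinuity of the
   optimal value.  When the simplex around theta is small, every
   x^gamma(theta_l) is thus close to C^gamma(theta), and the interpolant is
   equally close to a convex combination of k + 1 points of C^gamma(theta).
   This gives (a); (b) follows because such combinations form a compact set,
   near which f(., theta) is uniformly close to its values on that set. *)
Require Import Defs.
From HB Require Import structures.
From mathcomp Require Import all_boot all_order all_algebra.
From mathcomp Require Import all_classical all_reals all_analysis.
From mathcomp Require Import lra.

Set Implicit Arguments.
Unset Strict Implicit.
Unset Printing Implicit Defensive.

Import Order.TTheory GRing.Theory Num.Theory.
Import numFieldNormedType.Exports.

Local Open Scope classical_set_scope.
Local Open Scope ring_scope.

(** * Euclidean norm against sup norm *)

Lemma enorm_ge0 (R : realType) (n : nat) (v : 'rV[R]_n) : 0 <= enorm v.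
Proof. exact: sqrtr_ge0. Qed.

Lemma normr_le_enorm (R : realType) (n : nat) (v : 'rV[R]_n) :
  `|v| <= enorm v.
Proof.
rewrite [leLHS]/Num.norm /= mx_normrE; apply/bigmax_leP.
split=> [|[i j] _ /=]; first exact: enorm_ge0.
rewrite (ord1 i) -sqrtr_sqr ler_wsqrtr// (bigD1 j)//= lerDl.
by apply: sumr_ge0 => l _; rewrite sqr_ge0.
Qed.

Lemma enorm_continuous (R : realType) (n : nat) :
  continuous (@enorm R n).
Proof.
move=> v; apply: continuous_comp; last exact: sqrt_continuous.
apply: (@continuous_big R 'I_n +%R 0 xpredT) => [|i _].
  exact: add_continuous.
move=> w.
apply: (cvg_comp (fun u : 'rV[R]_n => u ord0 i) (fun x : R => x ^+ 2)).
  exact: coord_continuous.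
exact: exprn_continuous.
Qed.

(** Continuity of [enorm] at 0 gives the converse comparison of the norms, without an explicit
    factor depending on [n]. *)
Lemma enorm_small (R : realType) (n : nat) (e : R) : 0 < e ->
  exists2 r : R, 0 < r & forall v : 'rV[R]_n, `|v| < r -> enorm v < e.
Proof.
move=> e0; have enorm0 : enorm (0 : 'rV[R]_n) = 0.
  rewrite /enorm big1 ?sqrtr0// => i _.
  by rewrite mxE expr0n.
have /cvgrPdist_lt/(_ e e0)/nbhs_ballP[r /= r0 br] :=
  @enorm_continuous R n 0.
exists r => // v vr; have := br v.
rewrite enorm0 sub0r normrN ger0_norm ?enorm_ge0//.
by apply; rewrite -ball_normE /= sub0r normrN.
Qed.

(** * Compactness: uniform neighbourhoods, convex hulls, diameters *)

(** Tube lemma with a uniform radius: covering compactness is applied to the filter of radii tending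
    to 0 from the right. *)
Lemma compact_tube (R : realType) (U V : normedModType R) (K : set U) (b : V)
    (P : U -> V -> Prop) :
  compact K -> (forall x, K x -> \forall p \near (x, b), P p.1 p.2) ->
  exists2 r : R, 0 < r & forall x y c, K x -> `|x - y| < r -> `|b - c| < r ->
    P y c.
Proof.
move=> /compact_near_coveringP cK nP.
pose Q (r : R) x := forall y c, `|x - y| < r -> `|b - c| < r -> P y c.
have : \forall r \near 0^'+, K `<=` Q r.
  apply: cK => x /nP /nbhs_ballP[e /= e0 be].
  have e20 : 0 < e / 2 by rewrite divr_gt0.
  (* Half of [e] is spent from [x] to [x'], the other half from [x'] to [y]. *)
  exists (ball x (e / 2), [set r | r < e / 2]) => /=.
    split; first exact: nbhsx_ballx.
    by apply: nbhs_right_lt.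
  move=> [x' r] [/= xx' re] y c x'y bc; apply: (be (y, c)); split => /=.
    rewrite (splitr e); apply: ball_triangle xx' _.
    by rewrite -ball_normE /=; exact: lt_trans re.
  rewrite -ball_normE /=; apply: lt_trans bc (lt_trans re _).
  by rewrite gtr_pMr// invf_lt1// ltr1n.
move=> KQ; have [r [r0 rQ]] : exists r : R, 0 < r /\ K `<=` Q r.
  apply: (@filter_ex _ (0^'+)); near=> r; split; near: r => //.
  exact: nbhs_right_gt.
by exists r => // x y c Kx; exact: rQ.
Unshelve. all: by end_near. Qed.

(* The interpolant always combines [k.+1] points; fixing the number of points
   makes the hull of a compact set compact without Caratheodory's theorem. *)
Definition hull_of_size (R : realType) (n p : nat) (A : set 'rV[R]_n) :
    set 'rV[R]_n :=
  [set x | exists (w : 'I_p -> 'rV[R]_n) (c : 'I_p -> R),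
    [/\ forall i, A (w i), forall i, 0 <= c i, \sum_i c i = 1
      & x = \sum_i c i *: w i]].

Lemma hull_of_size_sub (R : realType) (n p : nat) (A : set 'rV[R]_n) :
  hull_of_size p A `<=` convex_hull A.
Proof. by move=> x [w [c Hx]]; exists p, w, c. Qed.

(** The entries are arbitrary because rows of vectors occur below. *)
Lemma row_coord_continuous (T : topologicalType) (p : nat) (i : 'I_p) :
  continuous (fun u : 'rV[T]_p => u ord0 i).
Proof.
move=> u B Bu; exists (fun a b => if b == i then B else setT) => /=.
  by move=> a b; case: eqP => [->|_]; [rewrite (ord1 a)|exact: filterT].
by move=> w /(_ ord0 i); rewrite eqxx.
Qed.

(** The hull is a continuous image of a compact set: weights in the unit cube, cut by the closed
    condition that they sum to 1, paired with [p] points of [A]. *)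
Lemma compact_hull_of_size (R : realType) (n p : nat) (A : set 'rV[R]_n) :
  compact A -> compact (hull_of_size p A).
Proof.
move=> cA; pose T := ('rV[R]_p * 'rV['rV[R]_n]_p)%type.
pose D := [set c : 'rV[R]_p | forall i, `[0, 1]%classic (c ord0 i)] `*`
  [set w : 'rV['rV[R]_n]_p | forall i, A (w ord0 i)].
have cD : compact D.
  apply: compact_setX; last exact: (@rV_compact _ _ (fun=> A)).
  apply: (@rV_compact R _ (fun=> `[0, 1]%classic)) => _.
  exact: segment_compact.
pose s (u : T) : R := \sum_i u.1 ord0 i.
pose g (u : T) : 'rV[R]_n := \sum_i u.1 ord0 i *: u.2 ord0 i.
have c1 i : continuous (fun u : T => u.1 ord0 i).
  move=> u; apply: (cvg_comp fst (fun c : 'rV[R]_p => c ord0 i)).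
    exact: cvg_fst.
  exact: row_coord_continuous.
have c2 i : continuous (fun u : T => u.2 ord0 i).
  move=> u; apply: (cvg_comp snd (fun w : 'rV['rV[R]_n]_p => w ord0 i)).
    exact: cvg_snd.
  exact: row_coord_continuous.
have cs : continuous s.
  apply: (@continuous_big R 'I_p +%R 0 xpredT) => [|i _]; last exact: c1.
  exact: add_continuous.
have cg : continuous g.
  apply: (@continuous_big 'rV[R]_n 'I_p +%R 0 xpredT) => [|i _].
    exact: add_continuous.
  by move=> u; apply: cvgZ; [exact: c1|exact: c2].
rewrite (_ : hull_of_size p A = g @` (D `&` s @^-1` [set 1])).
  apply: continuous_compact; first exact: continuous_subspaceT.
  apply: compact_closedI => //.
  by apply: closed_comp => [u _|]; [exact: cs|exact: closed_eq].
apply/seteqP; split => [x [w [c [Aw c0 c_sum1 ->]]]|_ [u [[Du1 Du2] su] <-]].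
  exists (\row_i c i, \row_i w i); last by apply: eq_bigr => i _; rewrite !mxE.
  split; last by rewrite /= -c_sum1; apply: eq_bigr => i _; rewrite mxE.
  split=> i; rewrite mxE //= in_itv /= c0 /= -c_sum1.
  by rewrite (bigD1 i)//= lerDl sumr_ge0.
exists (fun i => u.2 ord0 i), (fun i => u.1 ord0 i); split => // i.
by have /= := Du1 i; rewrite in_itv => /andP[].
Qed.

Lemma convex_hull_range (R : realType) (n p : nat) (v : 'I_p -> 'rV[R]_n) :
  convex_hull (range v) = hull_of_size p (range v).
Proof.
apply/seteqP; split; last exact: hull_of_size_sub.
move=> x [q [w [c [wv c0 c1 ->]]]].
have /choice[h hw] : forall i, exists l, v l = w i.
  by move=> i; have [l _ <-] := wv i; exists l.
(* Repeated points are merged: [v l] receives the weights of all [w i] assigned to it by [h]. *)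
exists v, (fun l => \sum_(i | h i == l) c i); split.
- by move=> l; exists l.
- by move=> l; exact: sumr_ge0.
- by rewrite -[RHS]c1 (partition_big h xpredT).
- rewrite (partition_big h xpredT)//=; apply: eq_bigr => l _.
  by rewrite scaler_suml; apply: eq_bigr => i /eqP <-; rewrite hw.
Qed.

Lemma le_simplex_diameter (R : realType) (k p : nat) (v : 'I_p -> 'rV[R]_k)
    (x y : 'rV[R]_k) :
  convex_hull (range v) x -> convex_hull (range v) y ->
  enorm (x - y) <= simplex_diameter (range v).
Proof.
set H := convex_hull (range v) => Hx Hy.
have cH : compact H.
  rewrite /H convex_hull_range; apply: compact_hull_of_size.
  by apply: finite_compact; apply: finite_image; exact: finite_finset.
have ce : continuous (fun q : 'rV[R]_k * 'rV[R]_k => enorm (q.1 - q.2)).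
  move=> q; apply: continuous_comp; last exact: enorm_continuous.
  by apply: continuousB; [exact: cvg_fst|exact: cvg_snd].
have [|q] := @compact_EVT_max _ R
  (fun q : 'rV[R]_k * 'rV[R]_k => enorm (q.1 - q.2)) (H `*` H) _
  (compact_setX cH cH) (continuous_subspaceT ce); first by exists (x, y).
rewrite inE => Hq qmax; rewrite /simplex_diameter /max_of.
(* The default 0 of [max_of] is excluded, since the pair [q] attains the maximum on the compact
   product. *)
case: xgetP => [? _ [_]|/(_ (enorm (q.1 - q.2)))].
  by apply; exists (x, y).
case; split; first by exists q.
by move=> _ [z Hz <-]; apply: qmax; rewrite inE.
Qed.

Lemma subset_convex_hull (R : realType) (n : nat) (A : set 'rV[R]_n) :
  A `<=` convex_hull A.
Proof.
move=> x Ax; exists 1%N, (fun=> x), (fun=> 1); split => //.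
  by rewrite big_ord1.
by rewrite big_ord1 scale1r.
Qed.

(** * Optimal value and near-optimal sets *)

Section Problem.
Context (R : realType) (n k : nat).
Context (X : set 'rV[R]_n) (Theta : set 'rV[R]_k)
  (f : 'rV[R]_n -> 'rV[R]_k -> R) (C : 'rV[R]_k -> set 'rV[R]_n)
  (f_cont : {within X `*` Theta,
    continuous (fun p : 'rV[R]_n * 'rV[R]_k => f p.1 p.2)})
  (C_sub : forall theta, Theta theta -> C theta `<=` X)
  (C_cont : continuous_correspondence Theta C)
  (C_compact : forall theta, Theta theta -> compact (C theta))
  (C_neq0 : forall theta, Theta theta -> C theta !=set0).

(** Membership in [X] and [Theta] becomes a premise, so that the neighbourhood lives in the whole
    space, as [compact_tube] expects. *)
Lemma objective_near (x : 'rV[R]_n) (theta : 'rV[R]_k) (e : R) :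
  X x -> Theta theta -> 0 < e ->
  \forall p \near (x, theta), X p.1 -> Theta p.2 ->
    `|f x theta - f p.1 p.2| < e.
Proof.
move=> Xx Tt e0.
have /subspace_continuousP/(_ (x, theta)) := f_cont.
move=> /(_ (conj Xx Tt)) /cvgrPdist_lt/(_ e e0).
rewrite near_withinE.
by apply: filterS => p H Xp Tp; exact: (H (conj Xp Tp)).
Qed.

Lemma objective_nearl (x : 'rV[R]_n) (theta : 'rV[R]_k) (e : R) :
  X x -> Theta theta -> 0 < e ->
  \forall y \near x, X y -> `|f x theta - f y theta| < e.
Proof.
move=> Xx Tt e0; have /nbhs_ballP[r /= r0 br] := objective_near Xx Tt e0.
apply/nbhs_ballP; exists r => //= y xy Xy.
by apply: (br (y, theta)) => //; split => //=; exact: ballxx.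
Qed.

(** By the extreme value theorem the minimum is attained, which rules out the default value of
    [min_of]. *)
Lemma optimal_valueP (theta : 'rV[R]_k) : Theta theta ->
  (exists2 x, C theta x & f x theta = optimal_value f C theta) /\
  (forall x, C theta x -> optimal_value f C theta <= f x theta).
Proof.
move=> Tt.
have fc : {within C theta, continuous (fun x => f x theta)}.
  apply/subspace_continuousP => x Cx; apply/cvgrPdist_lt => e e0.
  apply: filterS (objective_nearl (C_sub Tt Cx) Tt e0) => y H Cy.
  by apply: H; exact: C_sub Tt _ Cy.
have [c] := EVT_min_rV (C_neq0 Tt) (C_compact Tt) fc.
rewrite inE => Cc cmin; rewrite /optimal_value /min_of.
case: xgetP => [_ _ [[x Cx <-] lb]|/(_ (f c theta))].
  by split; [exists x|move=> y Cy; apply: lb; exists y].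
case; split; first by exists c.
by move=> _ [z Cz <-]; apply: cmin; rewrite inE.
Qed.

Lemma suboptimal_setE (gamma : R) (theta : 'rV[R]_k) : Theta theta ->
  suboptimal_set f C gamma theta =
  [set x | C theta x /\ f x theta <= optimal_value f C theta + gamma].
Proof.
move=> /optimal_valueP[_ fmin]; apply/seteqP; split => x [Cx fx]; split => //;
  by move: fx; rewrite ger0_norm ?subr_ge0 ?fmin// lerBlDl.
Qed.

Lemma compact_suboptimal_set (gamma : R) (theta : 'rV[R]_k) : Theta theta ->
  compact (suboptimal_set f C gamma theta).
Proof.
move=> Tt; rewrite suboptimal_setE//.
have cC := C_compact Tt; have clC := compact_closed (@norm_hausdorff _ _) cC.
apply: (subclosed_compact _ cC) => [|x []//].
move=> x clx; have Cx : C theta x.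
  by apply: clC => B /clx[y [[Cy _] By]]; exists y.
split=> //; rewrite leNgt; apply/negP => fx.
(* A limit point with positive excess would have near-optimal points nearby whose values differ from
   its own by less than that excess. *)
have e0 : 0 < f x theta - (optimal_value f C theta + gamma) by rewrite subr_gt0.
have /clx[y [[Cy fy]]] := objective_nearl (C_sub Tt Cx) Tt e0.
move=> /(_ (C_sub Tt Cy)) /(le_lt_trans (ler_norm _)).
by rewrite ltrD2l ltrN2 ltNge fy.
Qed.

(** Lower hemicontinuity supplies, near a minimizer at [theta], a point feasible at [t]; its value
    bounds the optimal value at [t]. *)
Lemma optimal_value_usc (theta : 'rV[R]_k) (e : R) : Theta theta -> 0 < e ->
  \forall t \near theta, Theta t ->
    optimal_value f C t < optimal_value f C theta + e.
Proof.
move=> Tt e0; have [[x Cx fx] _] := optimal_valueP Tt.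
have /nbhs_ballP[r /= r0 br] := objective_near (C_sub Tt Cx) Tt e0.
have [d d0 dC] := (C_cont Tt).2 r r0.
have [s s0 sd] := enorm_small k d0.
(* [s] secures the Euclidean distance for hemicontinuity, [r] the variation of [f]. *)
apply/nbhs_ballP; exists (Num.min s r) => /=; first by rewrite lt_min s0.
rewrite -ball_normE => t /=; rewrite lt_min => /andP[ts tr] Tt'.
have [|y Cy xy] := dC t Tt' _ x Cx; first by exists theta => //; exact: sd.
have [_ /(_ y Cy) fy] := optimal_valueP Tt'.
apply: le_lt_trans fy _; rewrite -ltrBlDl -fx.
have := br (y, t); rewrite /= distrC => /(_ _ _ Tt') H.
apply: le_lt_trans (ler_norm _) _; apply: H (C_sub Tt' Cy).
split; rewrite /= -ball_normE //= distrC.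
exact: le_lt_trans (normr_le_enorm _) xy.
Qed.

(** Upper hemicontinuity brings [y] close to some point of [C theta]. Near a point of [C theta] that
    is not [gamma]-suboptimal there is no [gamma]-suboptimal [y], and compactness makes the radius
    uniform. *)
Lemma suboptimal_set_uhc (gamma : R) (theta : 'rV[R]_k) (e : R) :
  Theta theta -> 0 < e ->
  exists2 d : R, 0 < d & forall t y, Theta t -> enorm (theta - t) < d ->
    suboptimal_set f C gamma t y ->
    exists2 x, suboptimal_set f C gamma theta x & `|x - y| < e.
Proof.
move=> Tt e0; pose P y t := X y -> Theta t ->
  f y t <= optimal_value f C t + gamma ->
  exists2 x, suboptimal_set f C gamma theta x & `|x - y| < e.
have [|r r0 rP] := @compact_tube R _ _ (C theta) theta P (C_compact Tt).
  move=> x Cx; have Xx := C_sub Tt Cx.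
  have [fx|fx] := leP (f x theta) (optimal_value f C theta + gamma).
    apply/nbhs_ballP; exists e => //= -[y t] [/=].
    rewrite -ball_normE /= => xy _ _ _ _.
    by exists x => //; rewrite suboptimal_setE.
  (* Half the excess of [x]: one half covers the variation of [f], the other the rise of the optimal
     value, so [fy] becomes contradictory. *)
  pose h := (f x theta - (optimal_value f C theta + gamma)) / 2.
  have h0 : 0 < h by rewrite divr_gt0// subr_gt0.
  have usc : \forall p \near (x, theta), Theta p.2 ->
      optimal_value f C p.2 < optimal_value f C theta + h.
    have /nbhs_ballP[s /= s0 bs] := optimal_value_usc Tt h0.
    by apply/nbhs_ballP; exists s => //= -[y t] [_ /bs].
  apply: filterS2 usc (objective_near Xx Tt h0) => -[y t] /= Hu Hf Xy Tt' fy.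
  have := Hf Xy Tt'; have := Hu Tt'; rewrite ltr_norml /h in h0 *.
  lra.
have [d1 d10 dC] := (C_cont Tt).1 r r0.
exists (Num.min d1 r) => [|t y Tt']; first by rewrite lt_min d10.
rewrite lt_min => /andP[td tr]; rewrite suboptimal_setE// => -[Cy fy].
have [|x Cx xy] := dC t Tt' _ y Cy; first by exists theta.
apply: (rP x y t) => //; last exact: C_sub Cy.
- exact: le_lt_trans (normr_le_enorm _) xy.
- exact: le_lt_trans (normr_le_enorm _) tr.
Qed.

(** * Interpolation on a small simplex *)

(** Every vertex lies within the diameter of [theta], so each [xg (v l)] has a close point of the
    near-optimal set at [theta]; these points are combined with the same weights. The bound [delta]
    is chosen before the data and the triangulation. *)
Lemma interpolant_near_hull (gamma : R) (theta : 'rV[R]_k) (e : R) :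
  Theta theta -> 0 < e ->
  exists2 delta : R, 0 < delta &
    forall (m : nat) (t : 'I_m -> 'rV[R]_k) (xg : 'rV[R]_k -> 'rV[R]_n)
      (d : nat) (S : 'I_d -> set 'rV[R]_k) (j : 'I_d)
      (v : 'I_k.+1 -> 'rV[R]_k) (lambda : 'I_k.+1 -> R),
      training_data Theta f C gamma t xg ->
      triangulation (range t) S ->
      located S theta j v lambda ->
      simplex_diameter (S j) < delta ->
      exists2 x, hull_of_size k.+1 (suboptimal_set f C gamma theta) x &
        `|x - interpolant v lambda xg| < e.
Proof.
move=> Tt e0; have e20 : 0 < e / 2 by rewrite divr_gt0.
have [r r0 uhc] := suboptimal_set_uhc gamma Tt e20.
exists r => // m t xg d S j v lambda Htd [SP _ _ _] [thetaS Sv [l0 l1 _]] diam.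
have vS l : S j (v l) by rewrite Sv; exists l.
have near_v l : exists x,
    suboptimal_set f C gamma theta x /\ `|x - xg (v l)| < e / 2.
  (* The vertex is a data point, so its [xg] value is [gamma]-suboptimal there. *)
  have [i _ ti] := SP j _ (vS l); have [Tti] := Htd i.
  rewrite ti in Tti * => sub.
  have [|x Kx xe] := uhc _ _ Tti _ sub; last by exists x.
  apply: le_lt_trans diam; rewrite Sv.
  apply: le_simplex_diameter; rewrite -Sv//.
  exact: subset_convex_hull.
have /choice[w wP] := near_v.
exists (\sum_l lambda l *: w l).
  by exists w, lambda; split => // l; have [] := wP l.
rewrite /interpolant -sumrB; under eq_bigr do rewrite -scalerBr.
apply: le_lt_trans (ler_norm_sum _ _ _) _.
(* The weighted sum is bounded non-strictly by [e / 2], which leaves room for the strict bound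
   [e]. *)
apply: (@le_lt_trans _ _ (\sum_l lambda l * (e / 2))).
  apply: ler_sum => l _; rewrite normrZ ger0_norm// ler_wpM2l//.
  by rewrite ltW//; have [] := wP l.
by rewrite -mulr_suml l1 mul1r gtr_pMr// invf_lt1// ltr1n.
Qed.

End Problem.

Theorem theorem5p1 (R : realType) (n k : nat)
    (X : set 'rV[R]_n) (Theta : set 'rV[R]_k)
    (f : 'rV[R]_n -> 'rV[R]_k -> R) (C : 'rV[R]_k -> set 'rV[R]_n)
    (gamma : R)
    (f_cont : {within X `*` Theta,
                continuous (fun p : 'rV[R]_n * 'rV[R]_k => f p.1 p.2)})
    (C_sub : forall theta, Theta theta -> C theta `<=` X)
    (C_cont : continuous_correspondence Theta C)
    (C_compact : forall theta, Theta theta -> compact (C theta))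
    (C_neq0 : forall theta, Theta theta -> C theta !=set0)
    (gamma_ge0 : 0 <= gamma)
    (theta : 'rV[R]_k) (theta_in : Theta theta) :
  (convex_hull (suboptimal_set f C gamma theta) `<=` C theta ->
   forall eps : R, 0 < eps -> exists2 delta : R, 0 < delta &
     forall (m : nat) (t : 'I_m -> 'rV[R]_k) (xg : 'rV[R]_k -> 'rV[R]_n)
       (d : nat) (S : 'I_d -> set 'rV[R]_k) (j : 'I_d)
       (v : 'I_k.+1 -> 'rV[R]_k) (lambda : 'I_k.+1 -> R),
       training_data Theta f C gamma t xg ->
       triangulation (range t) S ->
       convex_hull (range t) theta ->
       located S theta j v lambda ->
       simplex_diameter (S j) < delta ->
       infeasible_solution C eps theta (interpolant v lambda xg))
  /\
  (* [f] is only defined on [X * Theta]: the membership conditions in [X] below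
     make explicit that the values of [f] occurring here are defined *)
  ((forall x, convex_hull (suboptimal_set f C gamma theta) x ->
      X x /\ `|f x theta - optimal_value f C theta| <= gamma) ->
   forall eps : R, 0 < eps -> exists2 delta : R, 0 < delta &
     forall (m : nat) (t : 'I_m -> 'rV[R]_k) (xg : 'rV[R]_k -> 'rV[R]_n)
       (d : nat) (S : 'I_d -> set 'rV[R]_k) (j : 'I_d)
       (v : 'I_k.+1 -> 'rV[R]_k) (lambda : 'I_k.+1 -> R),
       training_data Theta f C gamma t xg ->
       triangulation (range t) S ->
       convex_hull (range t) theta ->
       located S theta j v lambda ->
       simplex_diameter (S j) < delta ->
       X (interpolant v lambda xg) ->
       suboptimal_solution f C (eps + gamma) theta (interpolant v lambda xg)).
Proof.
split=> [hullC|hullf] eps eps0.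
  (* The distance to the hull is controlled in the sup norm, whereas infeasibility is Euclidean. *)
  have [r r0 small] := enorm_small n eps0.
  have [d d0 near_hull] := interpolant_near_hull f_cont C_sub C_cont C_compact
    C_neq0 gamma theta_in r0.
  exists d => // m t xg D S j v lambda Htd HS _ Hl diam.
  have [x Kx xr] := near_hull _ _ _ _ _ _ _ _ Htd HS Hl diam.
  by exists x; [exact/hullC/(hull_of_size_sub Kx)|exact: small].
pose P y t := X y -> Theta t ->
  `|f y t - optimal_value f C theta| < eps + gamma.
have cK := compact_hull_of_size (p := k.+1)
  (compact_suboptimal_set f_cont C_sub C_compact C_neq0 (gamma := gamma)
    theta_in).
have [x /hull_of_size_sub/hullf[Xx fx]|r r0 rP] :=
  compact_tube (b := theta) (P := P) cK.
  (* [eps] pays for moving away from [x], [gamma] for the error at [x] given by the hypothesis on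
     the hull. *)
  apply: filterS (objective_near f_cont Xx theta_in eps0) => -[y t] /= H Xy Tt.
  rewrite -(subrKA (f x theta)) (le_lt_trans (ler_normD _ _))//.
  by rewrite ltr_leD// distrC H.
have [d d0 near_hull] := interpolant_near_hull f_cont C_sub C_cont C_compact
  C_neq0 gamma theta_in r0.
exists d => // m t xg D S j v lambda Htd HS _ Hl diam Xhat.
have [x Kx xr] := near_hull _ _ _ _ _ _ _ _ Htd HS Hl diam.
have [[z Cz fz] _] := optimal_valueP f_cont C_sub C_compact C_neq0 theta_in.
exists z => //; rewrite fz.
(* The tube is used with the parameter fixed at [theta]. *)
by apply: (rP x _ theta Kx xr) => //; rewrite subrr normr0.
Qed.
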